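(* Let $P_1$ be the uniform distribution on $[0,\frac12]$, let $P_2$ be the discrete distribution with mass $\frac13$ at each point of $D=\{\frac23,\frac56,1\}$, and let $P=\frac12P_1+\frac12P_2$. Then $$\lim_{n\to\infty}n^2V_n(P)=\frac1{96}.$$
   Context: For a Borel probability measure $Q$ on $\mathbb R$ with finite second moment, the $n$th quantization error is $V_n(Q)=\inf\{\int\min_{a\in\alpha}(x-a)^2\,dQ(x):\alpha\subset\mathbb R,\ 1\le\mathrm{card}(\alpha)\le n\}$. *)

(* Defs.v *)
From HB Require Import structures.
From mathcomp Require Import all_boot all_order all_algebra finmap lra.
From mathcomp Require Import all_classical all_reals all_analysis.

Set Implicit Arguments.
Unset Strict Implicit.
Unset Printing Implicit Defensive.

Import Order.TTheory GRing.Theory Num.Theory.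
Import numFieldNormedType.Exports.

Local Open Scope classical_set_scope.
Local Open Scope ring_scope.
Local Open Scope ereal_scope.

(* The codebooks range over finite sets [A] with 1 <= #|A| <= n, so the default
   value [+oo] of the big minimum never survives. The infimum is taken in
   [\bar R]; it is finite when 1 <= n and [Q] has a finite second moment, and
   [quantization_error Q 0 = +oo]. *)
Definition quantization_error (R : realType)
    (Q : probability (measurableTypeR R) R) (n : nat) : \bar R :=
  ereal_inf [set \int[Q]_x \big[Order.min/+oo]_(a <- A) ((x - a) ^+ 2)%:E
            | A in [set A : {fset R} | (1 <= #|` A| <= n)%N]].

Section mixture.
Context {R : realType}.

Lemma half_gt0 : (0 < 2^-1 :> R)%R.
Proof. by rewrite invr_gt0. Qed.

Definition P1 : probability (measurableTypeR R) R := uniform_prob half_gt0.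

Definition D : seq R := [:: 2 / 3; 5 / 6; 1]%R.

Definition unif_D : set (measurableTypeR R) -> \bar R :=
  mscale (3^-1)%:nng%R (msum (fun i => dirac (nth 0%R D i : measurableTypeR R)) 3).

HB.instance Definition _ := Measure.on unif_D.

Lemma unif_D_setT : unif_D setT = 1.
Proof.
rewrite /unif_D /mscale /= /msum !big_ord_recr big_ord0 /= !diracT -!EFinD -EFinM.
by congr EFin; lra.
Qed.

HB.instance Definition _ :=
  Measure_isProbability.Build _ _ _ unif_D unif_D_setT.

Definition P2 : probability (measurableTypeR R) R := unif_D.

Definition half_mixture : set (measurableTypeR R) -> \bar R :=
  measure_add (mscale (2^-1)%:nng%R P1) (mscale (2^-1)%:nng%R P2).

HB.instance Definition _ := Measure.on half_mixture.

Lemma half_mixture_setT : half_mixture setT = 1.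
Proof.
have -> : half_mixture setT = (2^-1)%:E * P1 setT + (2^-1)%:E * P2 setT.
  exact: measure_addE.
rewrite !probability_setT !mule1 -EFinD.
by congr EFin; lra.
Qed.

HB.instance Definition _ :=
  Measure_isProbability.Build _ _ _ half_mixture half_mixture_setT.

Definition P : probability (measurableTypeR R) R := half_mixture.

End mixture.

(* Main.v *)
(* The continuous part of P has density 1 on [0, 1/2], so the cost of a codebook
   is at least the integral over [0, 1/2] of the squared distance to it.
   With r = 1/(4n), every x satisfies
     min_a (x - a)^2 + sum_a (r^2 - (x - a)^2)^+ >= r^2,
   and integrating gives the cost at least r^2/2 - n (4/3) r^3 = 1/(96 n^2) for a
   codebook of n points. Conversely D together with the m midpoints of the
   uniform subdivision of [0, 1/2] has cost at most 1/(96 m^2) with m + 3 points,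
   so n^2 V_n lies between 1/96 and (1/96) (n/(n-3))^2. *)

Require Import Defs.
From mathcomp Require Import all_boot all_order all_algebra.
From mathcomp Require Import all_classical all_reals all_analysis.
From mathcomp Require Import measurable_realfun finmap ring lra.

Set Implicit Arguments.
Unset Strict Implicit.
Unset Printing Implicit Defensive.

Import Order.TTheory GRing.Theory Num.Theory.
Import numFieldNormedType.Exports.
Local Open Scope classical_set_scope.
Local Open Scope ring_scope.

Definition sqdist {R : realType} (s : seq R) (x : R) : \bar R :=
  \big[Order.min/+oo%E]_(a <- s) ((x - a) ^+ 2)%:E.

Lemma measurable_sqdist {R : realType} (s : seq R) :
  measurable_fun [set: R] (sqdist s).
Proof.
elim: s => [|a s ih].
  rewrite (_ : sqdist _ = cst +oo%E) //.
  by apply/funext => x; rewrite /sqdist big_nil.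
rewrite (_ : sqdist _ = fun x => Order.min ((x - a) ^+ 2)%:E (sqdist s x));
  last by apply/funext => x; rewrite /sqdist big_cons.
apply: measurable_mine => //.
apply/measurable_EFinP; apply: measurable_funX.
exact: measurable_funB.
Qed.

Lemma sqdist_ge0 {R : realType} (s : seq R) (x : R) : (0 <= sqdist s x)%E.
Proof. by apply: le_bigmin => // a _; rewrite lee_fin sqr_ge0. Qed.

Lemma sqdist_le {R : realType} (s : seq R) (a x : R) :
  a \in s -> (sqdist s x <= ((x - a) ^+ 2)%:E)%E.
Proof. by move=> sa; apply: bigmin_inf_seq sa _ _. Qed.

Lemma sqdist_mem {R : realType} (s : seq R) (a : R) :
  a \in s -> sqdist s a = 0%E.
Proof.
move=> sa; apply/eqP; rewrite eq_le sqdist_ge0 andbT.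
by apply: le_trans (sqdist_le _ sa) _; rewrite subrr expr0n.
Qed.

(** The density 2 of the uniform law on [0, 1/2] cancels the weight 1/2, which leaves Lebesgue
    measure; each atom of [D] has mass 1/2 * 1/3 = 1/6. *)
Lemma integral_P_sqdist {R : realType} (s : seq R) :
  (\int[@P R]_x sqdist s x =
    \int[lebesgue_measure]_(x in `[0%R, 2^-1%R]%classic) sqdist s x
    + (6^-1)%:E * \sum_(i < 3) sqdist s (nth 0%R D i))%E.
Proof.
have ms := measurable_sqdist s; have s0 := sqdist_ge0 s.
transitivity (\int[measure_add (mscale (2^-1)%:nng%R (@P1 R))
  (mscale (2^-1)%:nng%R (@P2 R))]_x sqdist s x)%E => //.
rewrite ge0_integral_measure_add// !ge0_integral_mscale//=.
rewrite integral_uniform// subr0 invrK muleA -EFinM mulVf// mul1e.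
congr (_ + _)%E.
rewrite ge0_integral_measure_sum// muleA -EFinM.
congr (_ * _)%E; first by congr EFin; field.
by apply: eq_bigr => i _; rewrite integral_dirac// diracT mul1e.
Qed.

(** One family serves both bounds: [u = r^2], [v = -1] gives the positive part (r^2 - (x - c)^2)^+,
    and [u = 0], [v = 1] gives the squared distance to [c], cut off outside a cell of half-length
    [r]. *)
Definition bump {R : realType} (u v r c : R) : R -> \bar R :=
  (fun x => (u + v * (x - c) ^+ 2)%:E) \_ `[c - r, c + r]%classic.

Lemma integral_quadratic {R : realType} (u v r c : R) : 0 < r ->
  (\int[lebesgue_measure]_(x in `[(c - r)%R, (c + r)%R]%classic)
      (u + v * (x - c) ^+ 2)%:E
    = (2 * u * r + 2 / 3 * v * r ^+ 3)%:E)%E.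
Proof.
move=> r0.
pose F (x : R) : R := u * x + v / 3 * (x - c) ^+ 3.
have dF (x : R) : is_derive x 1 F (u + v * (x - c) ^+ 2).
  by rewrite /F; apply: is_derive_eq; rewrite /GRing.scale/=; field.
have cF : continuous F.
  by move=> x; apply/differentiable_continuous/derivable1_diffP.
rewrite (@continuous_FTC2 _ (fun x => u + v * (x - c) ^+ 2) F).
- by rewrite -EFinB /F; congr EFin; field.
- lra.
- apply: continuous_subspaceT => x.
  exact/differentiable_continuous/derivable1_diffP.
- split.
  + by move=> x _.
  + exact/cvg_at_right_filter/cF.
  + exact/cvg_at_left_filter/cF.
- by move=> x _; rewrite derive1E derive_val.
Qed.

Section bump_sum.
Context {R : realType} (u v r : R).
Context (r_gt0 : 0 < r) (uv_ge0 : forall y, `|y| <= r -> 0 <= u + v * y ^+ 2).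

Lemma measurable_bump (c : R) : measurable_fun [set: R] (bump u v r c).
Proof.
apply/(measurable_restrictT _ (measurable_itv _)); apply: measurable_funTS.
apply/measurable_EFinP.
apply: measurable_funD => //; apply: measurable_funM => //.
by apply: measurable_funX; apply: measurable_funB.
Qed.

Lemma bump_ge0 (c x : R) : (0 <= bump u v r c x)%E.
Proof.
apply: erestrict_ge0 => y /=; rewrite in_itv/= lee_fin => yc.
by apply: uv_ge0; rewrite ler_distl.
Qed.

(** Each bump is nonnegative, so enlarging [A] to the whole line can only increase its integral;
    overlapping bumps are counted separately. *)
Lemma integral_bump_sum_le (s : seq R) (A : set R) : measurable A ->
  (\int[lebesgue_measure]_(x in A) (\sum_(c <- s) bump u v r c x)
    <= ((size s)%:R * (2 * u * r + 2 / 3 * v * r ^+ 3))%:E)%E.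
Proof.
move=> mA; rewrite ge0_integral_sum//; last 2 first.
- by move=> c; apply: measurable_funTS; exact: measurable_bump.
- by move=> c x _; exact: bump_ge0.
set w := 2 * u * r + _.
have -> : (size s)%:R * w = \sum_(c <- s) w.
  by rewrite big_const_seq count_predT iter_addr_0 mulr_natl.
rewrite -sumEFin; apply: lee_sum => c _.
rewrite -(integral_quadratic u v c r_gt0).
rewrite [leRHS]integral_mkcond; apply: ge0_subset_integral => //.
- exact: measurable_bump.
- by move=> x _; exact: bump_ge0.
Qed.

End bump_sum.

(** Induction on [s]. If the new point [a] is nearest, it suffices alone: for |x - a| <= r its
    squared distance and its bump add up to r^2, and otherwise (x - a)^2 > r^2. If it is not, the
    minimum is unchanged and the bump of [a] only adds. *)
Lemma sqdist_bump_ge {R : realType} (s : seq R) (r x : R) : 0 < r ->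
  ((r ^+ 2)%:E <= sqdist s x + \sum_(a <- s) bump (r ^+ 2) (-1) r a x)%E.
Proof.
move=> r0.
have b0 a : (0 <= bump (r ^+ 2) (-1) r a x)%E.
  by apply: bump_ge0 => // y; rewrite ler_norml => yr; nra.
elim: s => [|a s ih].
  by rewrite /sqdist !big_nil adde0 leey.
rewrite /sqdist !big_cons -/(sqdist s x).
case: (leP ((x - a) ^+ 2)%:E (sqdist s x)) => _; last first.
  by rewrite addeCA; apply: (le_trans ih); rewrite leeDr.
have s0 : (0 <= \sum_(b <- s) bump (r ^+ 2) (-1) r b x)%E.
  by apply: sume_ge0 => b _.
rewrite addeA; apply: le_trans (leeDl _ s0).
rewrite /bump patchE; case: ifPn => xa.
  rewrite -EFinD lee_fin; lra.
move: xa; rewrite notin_setE/= in_itv/= adde0 lee_fin => /negP.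
by rewrite negb_and -!ltNge => /orP[] ?; nra.
Qed.

Lemma integral_sqdist_ge {R : realType} (s : seq R) (n : nat) :
  (0 < n)%N -> (size s <= n)%N ->
  ((96 * n%:R ^+ 2)^-1%:E
    <= \int[lebesgue_measure]_(x in `[0%R, 2^-1%R]%classic) sqdist s x)%E.
Proof.
move=> n0 sn.
have N0 : 0 < n%:R :> R by rewrite ltr0n.
(* This value maximizes r^2/2 - (4/3) n r^3 over r > 0; n intervals of radius r then have total
   length 1/2. *)
pose r : R := (4 * n%:R)^-1.
have r0 : 0 < r by rewrite invr_gt0; lra.
have rb y : `|y| <= r -> 0 <= r ^+ 2 + -1 * y ^+ 2.
  by rewrite ler_norml => yr; nra.
have : (\int[lebesgue_measure]_(x in `[0%R, 2^-1%R]%classic) (r ^+ 2)%:E <=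
   \int[lebesgue_measure]_(x in `[0%R, 2^-1%R]%classic)
     (sqdist s x + \sum_(a <- s) bump (r ^+ 2) (-1) r a x))%E.
  apply: ge0_le_integral => //.
  - by move=> x _; rewrite lee_fin sqr_ge0.
  - apply: measurable_funTS; apply: emeasurable_funD.
      exact: measurable_sqdist.
    by apply: emeasurable_sum => a; exact: measurable_bump.
  - by move=> x _; exact: sqdist_bump_ge.
rewrite integral_cst//= lebesgue_measure_itv/= lte_fin invr_gt0 ltr0n/=.
rewrite oppr0 adde0.
rewrite ge0_integralD//; last 4 first.
- by move=> *; exact: sqdist_ge0.
- by apply: measurable_funTS; exact: measurable_sqdist.
- by move=> x _; apply: sume_ge0 => a _; exact: (bump_ge0 rb).
- apply: measurable_funTS; apply: emeasurable_sum => a.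
  exact: measurable_bump.
set I := (X in (_ <= X + _)%E -> _).
have /(@leeD2l _ I) := integral_bump_sum_le r0 rb s (measurable_itv `[0, 2^-1]).
move=> + h => /(le_trans h).
(* [I] is [+oo] when [s] is empty, but the bound on the bumps is a real number and may be
   subtracted. *)
rewrite -EFinM -leeBlDr// -EFinB; apply: le_trans.
rewrite lee_fin.
have sn' : (size s)%:R <= n%:R :> R by rewrite ler_nat.
have -> : (96 * n%:R ^+ 2)^-1 =
    r ^+ 2 / 2 - n%:R * (2 * r ^+ 2 * r + 2 / 3 * -1 * r ^+ 3).
  by rewrite /r; field; rewrite gt_eqF.
(* One bump has integral 2 r^3 - (2/3) r^3 >= 0, so replacing [size s] by [n] only weakens the
   bound. *)
rewrite lerB// ler_wpM2r//.
by have := exprn_gt0 3 r0; nra.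
Qed.

Lemma cell_exists {R : realType} (h x : R) (m : nat) :
  0 <= x <= m.+1%:R * h ->
  exists2 i, (i < m.+1)%N & i%:R * h <= x <= i.+1%:R * h.
Proof.
elim: m => [|m ih] /andP[x0 xm]; first by exists 0%N; rewrite // mul0r x0.
have [xh|hx] := leP x (m.+1%:R * h); last by exists m.+1; rewrite ?(ltW hx).
have [|i im hi] := ih; first by rewrite x0.
by exists i => //; exact: ltn_trans im _.
Qed.

(** Cell [i] of the uniform subdivision of [0, 1/2] is [i/(2m), (i+1)/(2m)]. *)
Definition midpoints {R : realType} (m : nat) : seq R :=
  mkseq (fun i => (2 * i + 1)%:R / (4 * m%:R)) m.

(** Extra points of [s] only lower the distance. On each cell the squared distance to the midpoint
    is a bump of integral (2/3) r^3, and there are m+1 cells. *)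
Lemma integral_midpoints_le {R : realType} (s : seq R) (m : nat) :
  {subset midpoints m.+1 <= s} ->
  (\int[lebesgue_measure]_(x in `[0%R, 2^-1%R]%classic) sqdist s x
    <= (96 * m.+1%:R ^+ 2)^-1%:E)%E.
Proof.
move=> cs; pose r : R := (4 * m.+1%:R)^-1.
have M0 : 0 < m.+1%:R :> R by rewrite ltr0n.
have r0 : 0 < r by rewrite invr_gt0; lra.
have rb (y : R) : `|y| <= r -> 0 <= 0 + 1 * y ^+ 2.
  by rewrite add0r mul1r sqr_ge0.
have := integral_bump_sum_le r0 rb (midpoints m.+1) (measurable_itv `[0, 2^-1]).
rewrite size_mkseq.
have -> : m.+1%:R * (2 * 0 * r + 2 / 3 * 1 * r ^+ 3) =
    (96 * m.+1%:R ^+ 2)^-1 :> R.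
  by rewrite /r; field; rewrite gt_eqF.
apply: le_trans; apply: ge0_le_integral => //.
- by move=> *; exact: sqdist_ge0.
- by apply: measurable_funTS; exact: measurable_sqdist.
- apply: measurable_funTS; apply: emeasurable_sum => a.
  exact: measurable_bump.
move=> x /=; rewrite in_itv/= => /andP[x0 x1].
(* [2 * r] is the cell length: (m+1) 2r = 1/2. *)
have [|i im /andP[ix xi]] := @cell_exists _ (2 * r) x m.
  rewrite x0 /= /r; apply: le_trans x1 _.
  by rewrite le_eqVlt; apply/orP; left; apply/eqP; field; rewrite gt_eqF.
pose c : R := (2 * i + 1)%:R / (4 * m.+1%:R).
have cm : c \in midpoints m.+1 by apply/mapP; exists i; rewrite ?mem_iota.
have cE : c = (2 * i%:R + 1) * r by rewrite /c natrD natrM.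
apply: le_trans (sqdist_le _ (cs _ cm)) _.
(* The bump at [c] already dominates; the others are nonnegative. *)
rewrite (big_rem c)//= -[leLHS]adde0; apply: leeD.
  rewrite /bump patchE mem_set ?add0r ?mul1r//=.
  by rewrite in_itv/= cE; move: ix xi; rewrite -(natr1 i); lra.
by apply: sume_ge0 => b _; exact: (bump_ge0 rb).
Qed.

Lemma quantization_error_P_ge {R : realType} (n : nat) : (0 < n)%N ->
  ((96 * n%:R ^+ 2)^-1%:E <= quantization_error (@P R) n)%E.
Proof.
move=> n0; apply/ereal_infP => _ [A /= /andP[_ An] <-].
rewrite -/(sqdist _ _) [leRHS]integral_P_sqdist.
apply: le_trans (integral_sqdist_ge n0 An) _.
rewrite leeDl// mule_ge0//; apply: sume_ge0 => i _; exact: sqdist_ge0.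
Qed.

(** Three points placed on [D] make the atoms cost nothing, and m+1 midpoints handle the Lebesgue
    part. *)
Lemma quantization_error_P_le {R : realType} (m : nat) :
  (quantization_error (@P R) (m + 4) <= (96 * m.+1%:R ^+ 2)^-1%:E)%E.
Proof.
pose s : seq R := D ++ midpoints m.+1.
pose A : {fset R} := [fset x in s]%fset.
have sA : {subset s <= A} by move=> x xs; rewrite in_fset.
have A4 : (1 <= #|` A| <= m + 4)%N.
  rewrite card_fseq; apply/andP; split.
    rewrite -has_predT; apply/hasP; exists 1 => //.
    by rewrite mem_undup !inE eqxx !orbT.
  apply: leq_trans (size_undup _) _.
  by rewrite size_cat size_mkseq /= addnC addSnnS.
have DA i : (i < 3)%N -> nth 0 D i \in (A : seq R).
  by move=> i3; apply: sA; rewrite mem_cat mem_nth.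
apply: le_trans (ereal_inf_lbound _) _; first by exists A.
rewrite /= -/(sqdist _ _) [leLHS]integral_P_sqdist
  big1 ?mule0 ?adde0; last first.
  by move=> i _; apply: sqdist_mem; exact: DA.
apply: integral_midpoints_le => x xm.
by apply: sA; rewrite mem_cat xm orbT.
Qed.

Theorem proposition2p7 (R : realType) :
  ((n%:R ^+ 2)%:E * quantization_error (@P R) n)%E @[n --> \oo]
    --> (1 / 96 : R)%:E.
Proof.
(* With n+4 points the upper bound is 1/96 ((n+4)/(n+1))^2, and (n+4)/(n+1) = 1 + 3/(n+1), where
   [harmonic n] is 1/(n+1). *)
rewrite -(cvg_shiftn 4).
apply: (@squeeze_cvge nat \oo _ R (fun=> (1 / 96)%:E) _
  (fun n => (1 / 96 * ((1 + 3 * harmonic n) * (1 + 3 * harmonic n)))%:E)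
  _ (1 / 96)%:E).
- apply: nearW => n.
  have N0 : 0 < (n + 4)%:R :> R by rewrite ltr0n addnS.
  apply/andP; split.
    apply: le_trans (lee_wpmul2l _ (@quantization_error_P_ge R (n + 4) _)).
    + rewrite -EFinM lee_fin le_eqVlt; apply/orP; left; apply/eqP.
      by field; rewrite gt_eqF.
    + by rewrite lee_fin sqr_ge0.
    + by rewrite addnS.
  apply: le_trans (lee_wpmul2l _ (quantization_error_P_le n)) _.
    by rewrite lee_fin sqr_ge0.
  rewrite -EFinM lee_fin le_eqVlt; apply/orP; left; apply/eqP.
  rewrite /harmonic/= natrD -natr1; field.
  by rewrite nat1r pnatr_eq0.
- exact: cvg_cst.
- apply/cvg_EFin; first by apply: nearW.
  have h1 : 1 + 3 * harmonic n @[n --> \oo] --> (1 : R).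
    rewrite -[X in _ --> X]addr0 -(mulr0 3); apply: cvgD; first exact: cvg_cst.
    by apply: cvgM; [exact: cvg_cst|exact: cvg_harmonic].
  have h2 :
      (1 + 3 * harmonic n) * (1 + 3 * harmonic n) @[n --> \oo] --> (1 : R).
    by rewrite -[X in _ --> X]mulr1; exact: cvgM.
  by rewrite -[X in _ --> X]mulr1; apply: cvgM => //; exact: cvg_cst.
Qed.
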